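(* Let $p$ and $q$ be distinct primes, let $P$ be an elementary abelian group of order $p^{\alpha}$ and $Q$ an elementary abelian group of order $q^{\beta}$. Let $G = P \rtimes_{\theta} Q$ and $P = P_1 \times \cdots \times P_r$, where the $P_i$, $1 \leq i \leq r$, are pairwise non-isomorphic irreducible $\mathbb{Z}_pQ$-submodules of $P$. Let $S$ be a normal subgroup of $G$. Then one of the following holds. (i) $S \leq P$ is a $\mathbb{Z}_pQ$-submodule of $P$. Further, there exists a subset $\{i_1,\ldots,i_s\}$ of $\{1,\ldots,r\}$ such that $S = P_{i_1} \times \cdots \times P_{i_s}$. (ii) $S \leq \mathrm{Ker}(\theta)$. (iii) $S = \hat{P} \rtimes \hat{Q}$, where $\hat{P} \leq P$ is a $\mathbb{Z}_pQ$-submodule of $P$ containing a complement of $C_P(\hat{Q})$ in $P$, and $\hat{Q}$ is a subgroup of $Q$. Further, there exists a subset $\{l_1,\ldots,l_m\}$ of $\{1,\ldots,r\}$ such that $\hat{P} = P_{l_1} \times \cdots \times P_{l_m}$.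
   Context: $G=P\rtimes_\theta Q$ is the semidirect product with respect to the action homomorphism $\theta: Q\to \mathrm{Aut}(P)$; $P$ is regarded as a $\mathbb{Z}_pQ$-module, where $\mathbb{Z}_p$ is the field with $p$ elements, via this (conjugation) action, and $\mathrm{Ker}(\theta)\le Q$ is viewed as a subgroup of $G$. $C_P(\hat Q)$ is the set of elements of $P$ commuting with every element of $\hat Q$. A complement of $C_P(\hat{Q})$ in $P$ is a subgroup $K\le P$ with $P=C_P(\hat Q)\times K$. $\hat P\rtimes\hat Q$ denotes the internal semidirect product $\hat P\hat Q$. *)

(* Defs.v *)
(* MathComp finite groups. *)
From mathcomp Require Import all_boot all_order all_algebra all_fingroup all_solvable.

Set Implicit Arguments.
Unset Strict Implicit.
Unset Printing Implicit Defensive.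

Import GroupScope.

(* G is the semidirect product of P by Q along theta : Q -> Aut P, with P and Q
   identified with subgroups of G.  MathComp composes permutations from left to
   right and x ^ y = y^-1 * x * y, so that conjugation is a morphism. *)
Definition semidirect_along (gT : finGroupType) (G P Q : {group gT})
    (theta : {morphism Q >-> {perm gT}}) : Prop :=
  [/\ P ><| Q = G,
      theta @* Q \subset Aut P
    & {in P & Q, forall x y, x ^ y = theta y x}].

(* P is written multiplicatively: k : 'F_p acts on x \in P as x ^+ k, and
   y \in Q acts as theta y. *)
Definition ZpQ_submodule (p : nat) (gT : finGroupType) (P Q : {group gT})
    (theta : {morphism Q >-> {perm gT}}) (M : {group gT}) : Prop :=
  [/\ M \subset P,
      forall k : 'F_p, {in M, forall x, x ^+ k \in M}
    & {in Q & M, forall y x, theta y x \in M}].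

Definition ZpQ_irreducible (p : nat) (gT : finGroupType) (P Q : {group gT})
    (theta : {morphism Q >-> {perm gT}}) (M : {group gT}) : Prop :=
  [/\ ZpQ_submodule p P theta M,
      M :!=: 1
    & forall N : {group gT},
        ZpQ_submodule p P theta N -> N \subset M -> N :=: 1 \/ N :=: M].

Definition ZpQ_isomorphic (p : nat) (gT : finGroupType) (Q : {group gT})
    (theta : {morphism Q >-> {perm gT}}) (M N : {group gT}) : Prop :=
  exists f : {morphism M >-> gT},
    [/\ isom M N f,
        forall k : 'F_p, {in M, forall x, f (x ^+ k) = f x ^+ k}
      & {in Q & M, forall y x, f (theta y x) = theta y (f x)}].

(* Main.v *)
Require Import Defs.
From mathcomp Require Import all_boot all_order all_algebra all_fingroup all_solvable.

Set Implicit Arguments.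
Unset Strict Implicit.
Unset Printing Implicit Defensive.

Import GroupScope.

(** The third alternative always holds, with Phat = S :&: P and Qhat = S :&: Q;
    the first two describe the special cases Qhat = 1 and Phat = 1.

    P and Q are Hall subgroups of G for p and for p^', and a normal subgroup
    meets a Hall subgroup in a Hall subgroup of its own.  Hence
    S = (S :&: P) ><| (S :&: Q).  As S is normal, [~: P, Qhat] lies in both S
    and P, and coprime action on the abelian group P makes it a complement of
    'C_P(Qhat) ([coprime_abelian_cent_dprod]).

    That Phat is the product of some of the P_i is a fact on multiplicity-free
    semisimple modules ([submodule_bigdprod]).  Its core is that an irreducible
    submodule M of P is one of the P_i ([minnormal_bigdprod]): by Schur's lemma
    ([minnormal_isom]) each coordinate projection M -> P_i is trivial or an
    isomorphism, and two nontrivial projections would give isomorphic P_i and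
    P_j, so M has a single nonzero coordinate.  For a general submodule N, let
    H be the product of the P_i inside N and K that of the others.  The modular
    law gives N = H * (K :&: N); an irreducible submodule of K :&: N would be
    some P_i inside both H and K, so K :&: N = 1 and N = H.

    Everything is done with Q acting by conjugation: submodules are subgroups of
    P normalised by Q, and irreducible ones are those satisfying [minnormal]. *)

(** * Q-equivariant morphisms and irreducible subgroups *)

Definition equivariant (gT : finGroupType) (Q M : {set gT}) (f : gT -> gT) :=
  {in M & Q, forall x y, f (x ^ y) = f x ^ y}.

Definition equiv_isog (gT : finGroupType) (Q M N : {group gT}) : Prop :=
  exists2 f : {morphism M >-> gT}, isom M N f & equivariant Q M f.

Section EquivariantIsomorphisms.

Variables (gT : finGroupType) (Q : {group gT}).
Implicit Types M N H : {group gT}.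

(** The composite N -> M -> H. When N and H are factors onto which M projects
    isomorphically, this contradicts that the factors are not isomorphic. *)
Lemma equiv_isog_common_source M N H :
    Q \subset 'N(M) ->
  equiv_isog Q M N -> equiv_isog Q M H -> equiv_isog Q N H.
Proof.
move=> nMQ [f /isomP[injf fM] eqf] [g /isomP[injg gM] eqg].
have {fM} -> : N = (f @* M)%G by apply/val_inj.
exists (ifactm g injf).
  apply/isomP; split; first exact: injm_ifactm.
  by rewrite -gM; apply: im_ifactm.
move=> _ y /morphimP[x Mx _ ->] Qy; have Mxy: x ^ y \in M.
  by rewrite memJ_norm ?(subsetP nMQ).
by rewrite /= -eqf // !ifactmE // eqg.
Qed.

(** Schur's lemma: the kernel and the image of an equivariant morphism are
    normalised by Q, so irreducibility leaves no choice for either. *)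
Lemma minnormal_isom M H (f : {morphism M >-> gT}) :
    minnormal M Q -> minnormal H Q -> equivariant Q M f ->
    f @* M \subset H -> f @* M != 1 -> isom M H f.
Proof.
move=> /mingroupP[/andP[ntM nMQ] minM] /mingroupP[_ minH] eqf sfMH ntfM.
have nfMQ : Q \subset 'N(f @* M).
  apply/subsetP=> y Qy; rewrite inE.
  apply/subsetP=> _ /imsetP[_ /morphimP[x Mx _ ->] ->].
  by rewrite -eqf ?mem_morphim ?memJ_norm ?(subsetP nMQ).
have nkerQ : Q \subset 'N('ker f).
  apply/subsetP=> y Qy; rewrite inE; apply/subsetP=> _ /imsetP[x kx ->].
  have Mx := dom_ker kx; apply/kerP; first by rewrite memJ_norm ?(subsetP nMQ).
  by rewrite eqf // (mker kx) conj1g.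
apply/isomP; split; last by rewrite (minH (f @* M)%G) //= ntfM.
apply: contraR ntfM; rewrite subG1 => ntker.
have kerE : 'ker f = M by rewrite (minM ('ker f)%G) ?subsetIl //= ntker.
have : M \subset 'ker f by rewrite kerE.
by rewrite ker_trivg_morphim subG1 => /andP[].
Qed.

(** The projection onto a direct factor commutes with Q because both factors
    are normalised by Q. *)
Lemma dprod_equiv_proj (G K H : {group gT}) :
    K \x H = G -> Q \subset 'N(K) -> Q \subset 'N(H) ->
  exists f : {morphism G >-> gT},
    [/\ equivariant Q G f, f @* G \subset H & 'ker f = K].
Proof.
move=> defG nKQ nHQ; have [_ defKH cKH tiKH] := dprodP defG.
have cH : H \in [complements to K in G] by apply/sdprod_compl/dprodWsd.
have [nKG _] := dprod_normal2 defG.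
exists (Morphism (remgrM cH nKG)); split.
- move=> x y Gx Qy.
  have /mulsgP[k h Kk Hh ->] : x \in K * H by rewrite defKH.
  rewrite /= conjMg !remgrMid //.
  + by rewrite memJ_norm ?(subsetP nKQ).
  + by rewrite memJ_norm ?(subsetP nHQ).
- by apply/subsetP=> _ /morphimP[x _ Gx ->]; rewrite /= mem_remgr ?defKH.
apply/setP=> x; apply/idP/idP => [kx | Kx].
  have x1 : remgr K H x = 1 := mker kx.
  by rewrite (divgr_eq K H x) x1 mulg1 mem_divgr // defKH (dom_ker kx).
by apply/kerP; rewrite /= ?remgr1 // (subsetP (normal_sub nKG)).
Qed.

(** * Submodules of a multiplicity-free direct product *)

Lemma dprod_split (I : finType) (F : I -> {set gT}) (G : {group gT})
    (A : pred I) :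
    \big[dprod/1]_i F i = G ->
  exists H K : {group gT},
    [/\ \big[dprod/1]_(i | A i) F i = H,
        \big[dprod/1]_(i | ~~ A i) F i = K & H \x K = G].
Proof.
rewrite (bigID A) /= => defG; have [[H K defH defK] _ _ _] := dprodP defG.
by exists H, K; split=> //; rewrite -defH -defK.
Qed.

Lemma bigdprod_norm (I : finType) (F : I -> {group gT}) (A : pred I)
    (H : {group gT}) :
  \big[dprod/1]_(i | A i) F i = H -> (forall i, A i -> Q \subset 'N(F i)) ->
  Q \subset 'N(H).
Proof.
move/bigdprodWY=> <- nFQ; apply/norms_gen/norms_bigcup.
by apply/bigcapsP.
Qed.

(** K j consists of the elements whose j-th coordinate is trivial, so all
    coordinates of x other than the i-th vanish. *)
Lemma mem_bigdprod_component (I : finType) (F : I -> {group gT})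
    (G : {group gT}) (K : I -> {group gT}) i x :
    \big[dprod/1]_j F j = G ->
    (forall j, \big[dprod/1]_(k | k != j) F k = K j) ->
    x \in G -> (forall j, j != i -> x \in K j) ->
  x \in F i.
Proof.
move=> defG defK Gx Kx; have [c [Fc defx uniqc]] := mem_bigdprod defG Gx.
have c1 j : j != i -> c j = 1.
  move=> i'j; have [e [Fe defxe _]] := mem_bigdprod (defK j) (Kx j i'j).
  (* A factorisation of x inside K j, completed by 1 at j, must be c. *)
  rewrite -(uniqc (fun k => if k != j then e k else 1)) ?eqxx //.
    by move=> k _; case: ifP => [/Fe | _].
  by rewrite defxe big_mkcond.
suffices -> : x = c i by apply: Fc.
rewrite defx -(big_pred1_eq *%g i c) [RHS]big_mkcond /=.
by apply: eq_bigr => j _; case: eqP => // /eqP/c1.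
Qed.

(** An irreducible subgroup with two nontrivial coordinates i and j would be
    isomorphic to both F i and F j. *)
Lemma minnormal_bigdprod (I : finType) (F : I -> {group gT})
    (P M : {group gT}) :
    \big[dprod/1]_i F i = P -> (forall i, minnormal (F i) Q) ->
    (forall i j, i != j -> ~ equiv_isog Q (F i) (F j)) ->
    minnormal M Q -> M \subset P ->
  exists i, M :=: F i.
Proof.
move=> defP minF nisoF minM sMP.
have nFQ i : Q \subset 'N(F i) by case/mingroupP: (minF i) => /andP[].
have [/andP[ntM nMQ] _] := mingroupP minM.
have /fin_all_exists[K defK] i :
    exists K : {group gT},
      \big[dprod/1]_(j | j != i) F j = K /\ K \x F i = P.
  have [H [K [defH defK defHK]]] := dprod_split (pred1 i) defP.
  exists K; split=> //; rewrite dprodC -defHK -defH.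
  by rewrite big_pred1_eq.
have isoMF i : ~~ (M \subset K i) -> equiv_isog Q M (F i).
  move=> nsMK; have [defKi defPi] := defK i.
  have nKQ : Q \subset 'N(K i) by apply: bigdprod_norm defKi _.
  have [f [eqf sfPF kerf]] := dprod_equiv_proj defPi nKQ (nFQ i).
  have eqfM : equivariant Q M (restrm_morphism sMP f).
    by move=> x y Mx Qy; rewrite /= eqf // (subsetP sMP).
  exists (restrm_morphism sMP f) => //.
  have fME : restrm sMP f @* M = f @* M by rewrite morphim_restrm setIid.
  apply: minnormal_isom => //=.
    by rewrite fME (subset_trans _ sfPF) // morphimS.
  rewrite fME -subG1; apply: contra nsMK => sfM1.
  by rewrite -kerf ker_trivg_morphim sMP.
have [i nsMKi] : exists i, ~~ (M \subset K i).
  apply/existsP; rewrite -negb_forall; apply: contra ntM => /forallP sMK.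
  (* If all coordinates of x vanish, then x lies in K i0 and in F i0. *)
  have [i0 _ | noI] := pickP (@predT I).
    rewrite -subG1; apply/subsetP=> x Mx.
    have [_ /dprodP[_ _ _ <-]] := defK i0.
    rewrite inE (subsetP (sMK i0)) //=.
    apply: (mem_bigdprod_component defP (fun j => (defK j).1)).
      exact: (subsetP sMP).
    by move=> j _; apply: (subsetP (sMK j)).
  by rewrite -subG1 (subset_trans sMP) // -defP big_pred0.
have sMF : M \subset F i.
  apply/subsetP=> x Mx.
  apply: (mem_bigdprod_component defP (fun j => (defK j).1)).
    exact: (subsetP sMP).
  move=> j i'j; apply: (subsetP _ x Mx); apply: contraT => nsMKj.
  case: (nisoF i j); first by rewrite eq_sym.
  by apply: equiv_isog_common_source nMQ _ _; apply: isoMF.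
exists i; have [_ minFi] := mingroupP (minF i).
by rewrite (minFi M) ?ntM.
Qed.

(** By the modular law, the product of the factors not contained in N cuts out
    a complement in N of the product of those that are. An irreducible subgroup
    of this complement would be a factor contained in N, so it is trivial. *)
Lemma submodule_bigdprod (I : finType) (F : I -> {group gT})
    (P N : {group gT}) :
    \big[dprod/1]_i F i = P -> (forall i, minnormal (F i) Q) ->
    (forall i j, i != j -> ~ equiv_isog Q (F i) (F j)) ->
    N \subset P -> Q \subset 'N(N) ->
  exists A : {set I}, \big[dprod/1]_(i in A) F i = N.
Proof.
move=> defP minF nisoF sNP nNQ.
have nFQ i : Q \subset 'N(F i) by case/mingroupP: (minF i) => /andP[].
pose A := [set i | F i \subset N]; exists A.
have [H [K [defH defK defHK]]] := dprod_split (mem A) defP.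
have [_ defHK' _ tiHK] := dprodP defHK.
have sHN : H \subset N.
  by rewrite -(bigdprodWY defH) gen_subG; apply/bigcupsP=> i; rewrite /= inE.
have nNKQ : Q \subset 'N(K :&: N).
  by rewrite normsI // (bigdprod_norm defK).
suffices NK1 : K :&: N = 1.
  rewrite defH -[RHS](setIidPr sNP) -defHK' -group_modl //.
  by rewrite NK1 mulg1.
apply/eqP/idPn=> ntNK.
have [M minM sMNK] := minnormal_exists (H := (K :&: N)%G) ntNK nNKQ.
have [sMK sMN] := subsetIP sMNK.
have [i defM] := minnormal_bigdprod defP minF nisoF minM (subset_trans sMN sNP).
have Ai : i \in A by rewrite inE -defM.
have [/andP[/negP ntM _] _] := mingroupP minM; case: ntM.
rewrite -subG1 -tiHK subsetI sMK andbT defM -(bigdprodWY defH) sub_gen //.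
exact: (bigcup_max i).
Qed.

End EquivariantIsomorphisms.

(** * Coprime action on an abelian group *)

(** A acts trivially on G / [~: G, A]; by coprimality the fixed points of this
    quotient lift to fixed points in G, so 'C_G(A) covers it. *)
Lemma coprime_abelian_cent_dprod (gT : finGroupType) (A G : {group gT}) :
    A \subset 'N(G) -> coprime #|G| #|A| -> abelian G ->
  'C_G(A) \x [~: G, A] = G.
Proof.
move=> nGA coGA abG; have sRG : [~: G, A] \subset G by rewrite commg_subl.
have cRC : [~: G, A] \subset 'C('C_G(A)).
  by rewrite (sub_abelian_cent2 abG) ?subsetIl.
rewrite dprodE //; last first.
  rewrite setIAC (setIidPr sRG); exact: coprime_abel_cent_TI.
apply/eqP; rewrite eqEsubset mul_subG ?subsetIl //=.
have nRA : A \subset 'N([~: G, A]) by rewrite commg_normr.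
have nRG : G \subset 'N([~: G, A]) by rewrite commg_norml.
rewrite normC ?subIset ?nRG // -quotientSK //.
rewrite coprime_quotient_cent ?abelian_sol //.
by rewrite subsetI subxx quotient_cents2r.
Qed.

(** * Modules over the group algebra in terms of conjugation *)

Section Submodules.

Variables (p : nat) (gT : finGroupType) (G P Q : {group gT}).
Variable theta : {morphism Q >-> {perm gT}}.
Hypothesis defG : semidirect_along G P theta.

(** Closure under scalars is automatic, as k : 'F_p acts by a power map. *)
Lemma ZpQ_submoduleP (M : {group gT}) :
  ZpQ_submodule p P theta M <-> M \subset P /\ Q \subset 'N(M).
Proof.
have [_ _ actJ] := defG; split=> [[sMP _ MQ] | [sMP nMQ]].
  split=> //; apply/subsetP=> y Qy; rewrite inE.
  apply/subsetP=> _ /imsetP[x Mx ->].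
  by rewrite actJ ?(subsetP sMP) // MQ.
split=> // [k x Mx | y x Qy Mx]; first exact: groupX.
by rewrite -actJ ?(subsetP sMP) // memJ_norm ?(subsetP nMQ).
Qed.

Lemma ZpQ_irreducible_minnormal (M : {group gT}) :
  ZpQ_irreducible p P theta M -> minnormal M Q.
Proof.
case=> /ZpQ_submoduleP[sMP nMQ] ntM minM.
apply/mingroupP; split=> [|N /andP[ntN nNQ] sNM]; first by rewrite ntM.
have subN : ZpQ_submodule p P theta N.
  by apply/ZpQ_submoduleP; rewrite (subset_trans sNM).
have [N1 | /val_inj //] := minM N subN sNM.
by rewrite N1 eqxx in ntN.
Qed.

Lemma equiv_isog_ZpQ (M N : {group gT}) :
  M \subset P -> N \subset P -> Q \subset 'N(M) ->
  equiv_isog Q M N -> ZpQ_isomorphic p theta M N.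
Proof.
have [_ _ actJ] := defG => sMP sNP nMQ [f isof eqf]; exists f; split=> //.
  by move=> k x Mx; rewrite morphX.
move=> y x Qy Mx; rewrite -actJ ?(subsetP sMP) // eqf // actJ //.
by rewrite (subsetP sNP) // -(isom_im isof) mem_morphim.
Qed.

End Submodules.

Theorem corollary4p4 (p q alpha beta r : nat) (gT : finGroupType)
    (G P Q : {group gT}) (theta : {morphism Q >-> {perm gT}})
    (Pi : 'I_r -> {group gT}) (S : {group gT}) :
  prime p -> prime q -> p <> q ->
  p.-abelem P -> #|P| = (p ^ alpha)%N ->
  q.-abelem Q -> #|Q| = (q ^ beta)%N ->
  semidirect_along G P theta ->
  \big[dprod/1]_(i < r) Pi i = P ->
  (forall i, ZpQ_irreducible p P theta (Pi i)) ->
  (forall i j, i <> j -> ~ ZpQ_isomorphic p theta (Pi i) (Pi j)) ->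
  S <| G ->
  [\/ ZpQ_submodule p P theta S /\
        (exists I : {set 'I_r}, \big[dprod/1]_(i in I) Pi i = S),
      S \subset 'ker theta
    | exists Phat Qhat : {group gT},
        [/\ Phat ><| Qhat = S,
            ZpQ_submodule p P theta Phat,
            (exists2 K : {group gT}, K \subset Phat & 'C_P(Qhat) \x K = P),
            Qhat \subset Q
          & exists L : {set 'I_r}, \big[dprod/1]_(i in L) Pi i = Phat]].
Proof.
move=> p_pr q_pr /eqP neq_pq abelP _ abelQ _ defG defP irrP nisoP nsSG.
have [sdPQ _ _] := defG; have [_ defPQ nPQ _] := sdprodP sdPQ.
have [nsPG sQG _ _ _] := sdprod_context sdPQ.
have pP := abelem_pgroup abelP; have abP := abelem_abelian abelP.
have p'Q : p^'.-group Q.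
  by apply: pi_pnat (abelem_pgroup abelQ) _; rewrite !inE eq_sym.
have [hallP hallQ] := coprime_mulpG_Hall defPQ pP p'Q.
pose Phat := (S :&: P)%G; pose Qhat := (S :&: Q)%G.
have sPhatP : Phat \subset P by apply: subsetIr.
have nPhatQ : Q \subset 'N(Phat).
  by rewrite normsI // (subset_trans sQG) // normal_norm.
have sQhatQ : Qhat \subset Q by apply: subsetIr.
constructor 3; exists Phat, Qhat; split=> //.
- have nsPhatS : Phat <| S by apply: normalGI nsPG; apply: normal_sub.
  have hallPhat : p.-Hall(S) Phat.
    by rewrite /= setIC; apply: Hall_setI_normal nsSG hallP.
  have hallQhat : p^'.-Hall(S) Qhat.
    by rewrite /= setIC; apply: Hall_setI_normal nsSG hallQ.
  exact/(sdprod_normal_p'HallP nsPhatS hallQhat).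
- exact/(ZpQ_submoduleP p defG).
- have nPQhat := subset_trans sQhatQ nPQ.
  have coPQhat : coprime #|P| #|Qhat|.
    exact: pnat_coprime pP (pgroupS sQhatQ p'Q).
  exists [~: P, Qhat]%G; last exact: coprime_abelian_cent_dprod.
  rewrite subsetI commg_subl nPQhat andbT.
  rewrite (subset_trans (commgS _ (subsetIl S Q))) // commg_subr.
  by rewrite (subset_trans (normal_sub nsPG)) // normal_norm.
have subP i : Pi i \subset P /\ Q \subset 'N(Pi i).
  by have [/(ZpQ_submoduleP _ defG)] := irrP i.
apply: (submodule_bigdprod defP) nPhatQ => //.
  by move=> i; apply: (ZpQ_irreducible_minnormal defG).
move=> i j /eqP neq_ij isoij; apply: (nisoP i j neq_ij).
have [[sPiP nPiQ] [sPjP _]] := (subP i, subP j).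
exact: (equiv_isog_ZpQ p defG).
Qed.
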